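(* Let $x^*$ be the closed-loop trajectory generated by the receding horizon schema described in the context, with weight sequences $\varepsilon_i\in[0,1]$, $\rho_i\ge 1$ ($i=0,1,2,\dots$), and write $\Delta\varepsilon_i=\varepsilon_{i+1}-\varepsilon_i$, $\Delta\rho_i=\rho_{i+1}-\rho_i$. Assume: 1. The set $\Omega$ and the function $q$ are such that for every $x_s(0)\in\Omega$ there exists a piecewise continuous control $u_s:[0,\delta]\to U$ such that the trajectory $x_s$ of $\dot x=f(x,u)$ generated by this control remains in $\Omega$ and satisfies $$\frac{d}{d\tau}q(x_s(\tau))+L(x_s(\tau),u_s(\tau))\le 0,\qquad \tau\in[0,\delta].$$ 2. The problem $P(0,x_0)$ has a solution. 3. There is a fixed number $\xi\in(0,1)$ such that for every $i$: if $\overline T_i\ge T_{\min}+\delta$, then $$\Delta\varepsilon_i\int_{t_i+\delta}^{t_i+\overline T_i}L(\bar x^i,\bar u^i)\,ds+\Delta\rho_i\, q(\bar x^i(t_i+\overline T_i))\le \delta+(1-\xi)\varepsilon_i\int_{t_i}^{t_i+\delta}L(\bar x^i,\bar u^i)\,ds,$$ and if $\overline T_i\in[T_{\min},T_{\min}+\delta)$, then $$\Delta\varepsilon_i\Big(\int_{t_i+\delta}^{t_i+\overline T_i}L(\bar x^i,\bar u^i)\,ds+\int_{t_i+\overline T_i}^{t_i+T_{\min}+\delta}L(x_s,u_s)\,ds\Big)+\Delta\rho_i\, q(x_s(t_i+T_{\min}+\delta))\le(\overline T_i-T_{\min})+(1-\xi)\varepsilon_i\int_{t_i}^{t_i+\delta}L(\bar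 x^i,\bar u^i)\,ds,$$ where in the last inequality $u_s,x_s$ are the control and trajectory of assumption 1 with time shifted so that they start at time $t_i+\overline T_i$ from the point $x_s(t_i+\overline T_i)=\bar x^i(t_i+\overline T_i)\in\Omega$. 4. There exist numbers $i_0\ge 0$ and $\varepsilon_{\min}>0$ such that $\varepsilon_{\min}\le\varepsilon_i\le 1$ for all $i\ge i_0$. Then the trajectory $x^*(t)$ converges asymptotically to zero, i.e. $\lim_{t\to\infty}x^*(t)=0$.
   Context: Notation: $\|x\|_H=\sqrt{x^THx}$ for a symmetric positive definite matrix $H$. A function $\varphi:[0,\infty)\to[0,\infty)$ is of class $\mathcal K$ if it is continuous, strictly increasing and $\varphi(0)=0$. System: $\dot x(t)=f(x(t),u(t))$, $x(0)=x_0$, $t\ge 0$, where $f:\mathbb R^n\times\mathbb R^m\to\mathbb R^n$ is $C^1$ in both arguments, $f(0,0)=0$, and $f$ is Lipschitz in $x$ on $\mathbb R^n$ with a constant independent of $u$. Controls take values in $U=\{u\in\mathbb R^m: u_{\min}\le u\le u_{\max}\}$, where $u_{\min}<0<u_{\max}$ (componentwise). $\Omega\subset\mathbb R^n$ is a closed, bounded, simply connected set with $0\in\Omega$. Numbers $T_{\min}\ge\delta>0$ are fixed; $\delta$ is the sampling time, and $t_i=i\delta$. A control $u:[t,t+T]\to\mathbb R^m$ is admissible in the point $x_t$ if it is piecewise continuous, $u(s)\in U$ on $[t,t+T]$, and the solution of the system with control $u$ and initial condition $x(t)=x_t$ satisfies $x(t+T)\in\Omega$. The system is assumed asymptotically controllable: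 for every $x_0\in\mathbb R^n$ and $\eta>0$ there is an admissible control $u^D:[0,T_D]\to U$, $T_D<\infty$, steering $x_0$ to a point of norm less than $\eta$ at time $T_D$. Problem $P(t_i,x_{t_i})$: find a final time $T\ge T_{\min}$ and a control $u:[t_i,t_i+T]\to U$ admissible in $x_{t_i}$ minimizing $$J(u,T;x_{t_i})=T+\varepsilon_i\int_{t_i}^{t_i+T}L(x(s),u(s))\,ds+\rho_i\,q(x(t_i+T)),$$ where $x$ solves the system with control $u$ and initial condition $x(t_i)=x_{t_i}$. Here $L:\mathbb R^n\times\mathbb R^m\to[0,\infty)$ is $C^1$, $L(0,0)=0$, $L(x,u)\ge\alpha_L(\|x\|)$ with $\alpha_L\in\mathcal K$; $q:\mathbb R^n\to[0,\infty)$ is $C^1$, $q(0)=0$, $q(x)\ge c\|x\|_H^2$ for some constant $c>0$; $\varepsilon_i\in[0,1]$, $\rho_i\ge1$. It is assumed that solutions exist for initial states in all of $\mathbb R^n$ or in a sufficiently large set $X\supset\Omega$ (containing the states at which the problem is posed). A solution is denoted $\bar u^i,\overline T_i$, and the corresponding trajectory on $[t_i,t_i+\overline T_i]$ is $\bar x^i$. Receding horizon schema: at each $t_i$, $i=0,1,2,\dots$, the current state $x_{t_i}$ is measured, $\varepsilon_i,\rho_i$ are determined, $P(t_i,x_{t_i})$ is solved, and $\bar u^i$ is applied on $[t_i,t_i+\delta)$; then $i$ is increased by one. The closed-loop trajectory $x^*$ and control $u^*$ are the concatenations of $\bar x^i$, $\bar u^i$ restricted to $[t_i,t_{i+1})$,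 with $x^*(0)=x_0$. *)

(* Defs.v *)
From HB Require Import structures.
From mathcomp Require Import all_boot all_order all_algebra.
From mathcomp Require Import all_classical all_reals all_analysis.
Set Implicit Arguments.
Unset Strict Implicit.
Unset Printing Implicit Defensive.
Import Order.TTheory GRing.Theory Num.Theory.
Import numFieldNormedType.Exports.
Local Open Scope classical_set_scope.
Local Open Scope ring_scope.

(* The library norm on matrices is the sup norm. The norms of the control
   problem are ||x||_H and ||x|| = ||x||_I. Notions that do not depend on the
   choice of a norm (limits, boundedness, being Lipschitz for some constant)
   are taken from the library. *)
Definition Hnorm (R : realType) (n : nat) (H : 'M[R]_n) (x : 'cV[R]_n) : R :=
  Num.sqrt ((x^T *m H *m x) 0 0).

Definition enorm (R : realType) (n : nat) (x : 'cV[R]_n) : R := Hnorm 1%:M x.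

Definition sym_posdef (R : realType) (n : nat) (H : 'M[R]_n) : Prop :=
  H^T = H /\ forall x : 'cV[R]_n, x != 0 -> 0 < (x^T *m H *m x) 0 0.

(* Functions of class K are only considered on [0, +oo[; the values at
   negative arguments are irrelevant. *)
Definition class_K (R : realType) (phi : R -> R) : Prop :=
  [/\ {within `[0, +oo[, continuous phi},
      {in `[0, +oo[ &, {homo phi : r s / r < s}} & phi 0 = 0].

(* On finite-dimensional spaces, pointwise continuity of z |-> 'd F z is the
   same as its continuity for the operator norm. *)
Definition C1 (R : realType) (V W : normedModType R) (F : V -> W) : Prop :=
  (forall z, differentiable F z) /\ (forall v, continuous (fun z => 'd F z v)).

Definition simply_connected (R : realType) (V : normedModType R) (A : set V) :
    Prop :=
  [/\ A !=set0,
      forall a b, A a -> A b -> exists g : R -> V,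
        [/\ {within `[0, 1], continuous g},
            forall s, s \in `[0, 1] -> A (g s), g 0 = a & g 1 = b] &
      forall g : R -> V,
        {within `[0, 1], continuous g} ->
        (forall s, s \in `[0, 1] -> A (g s)) -> g 0 = g 1 ->
        exists h : R * R -> V,
          [/\ {within `[0, 1] `*` `[0, 1], continuous h},
              forall s t, s \in `[0, 1] -> t \in `[0, 1] -> A (h (s, t)),
              forall s, s \in `[0, 1] -> h (s, 0) = g s /\ h (s, 1) = g 0 &
              forall t, t \in `[0, 1] -> h (0, t) = g 0 /\ h (1, t) = g 0]].

Definition control_box (R : realType) (m : nat) (umin umax : 'cV[R]_m) :
    set 'cV[R]_m :=
  [set u | forall j, umin j 0 <= u j 0 <= umax j 0].

(* Finitely many discontinuities, with one-sided limits everywhere. *)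
Definition piecewise_continuous (R : realType) (V : normedModType R) (a b : R)
    (u : R -> V) : Prop :=
  [/\ exists D : seq R, forall s, s \in `]a, b[ -> s \notin D ->
        {for s, continuous u},
      forall s, s \in `[a, b[ -> cvg (u r @[r --> s^'+]) &
      forall s, s \in `]a, b] -> cvg (u r @[r --> s^'-])].

(* x is the solution on [a, b] of x' = f(x, u), x(a) = y. For a piecewise
   continuous control, the equation can fail at finitely many times. *)
Definition trajectory (R : realType) (n m : nat)
    (f : 'cV[R]_n -> 'cV[R]_m -> 'cV[R]_n) (a b : R) (y : 'cV[R]_n)
    (u : R -> 'cV[R]_m) (x : R -> 'cV[R]_n) : Prop :=
  [/\ {within `[a, b], continuous x}, x a = y &
      exists D : seq R, forall s, s \in `]a, b[ -> s \notin D ->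
        is_derive s 1 x (f (x s) (u s))].

Definition admissible (R : realType) (n m : nat)
    (f : 'cV[R]_n -> 'cV[R]_m -> 'cV[R]_n) (U : set 'cV[R]_m)
    (Omega : set 'cV[R]_n) (t T : R) (y : 'cV[R]_n) (u : R -> 'cV[R]_m) :
    Prop :=
  [/\ piecewise_continuous t (t + T) u,
      forall s, s \in `[t, t + T] -> U (u s) &
      exists x, trajectory f t (t + T) y u x /\ Omega (x (t + T))].

Definition asymptotically_controllable (R : realType) (n m : nat)
    (f : 'cV[R]_n -> 'cV[R]_m -> 'cV[R]_n) (U : set 'cV[R]_m)
    (Omega : set 'cV[R]_n) : Prop :=
  forall (y : 'cV[R]_n) (eta : R), 0 < eta ->
    exists (TD : R) (uD : R -> 'cV[R]_m) (x : R -> 'cV[R]_n),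
      [/\ 0 <= TD, admissible f U Omega 0 TD y uD,
          trajectory f 0 TD y uD x & enorm (x TD) < eta].

Definition int_cost (R : realType) (n m : nat)
    (L : 'cV[R]_n -> 'cV[R]_m -> R) (x : R -> 'cV[R]_n) (u : R -> 'cV[R]_m)
    (a b : R) : R :=
  \int[lebesgue_measure]_(s in `[a, b]) L (x s) (u s).

(* The trajectory x generated by u is passed explicitly. *)
Definition cost (R : realType) (n m : nat)
    (L : 'cV[R]_n -> 'cV[R]_m -> R) (q : 'cV[R]_n -> R) (eps rho t T : R)
    (u : R -> 'cV[R]_m) (x : R -> 'cV[R]_n) : R :=
  T + eps * int_cost L x u t (t + T) + rho * q (x (t + T)).

(* (T, u) solves P(t, y) with weights eps and rho; x is its trajectory. *)
Definition solves_P (R : realType) (n m : nat)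
    (f : 'cV[R]_n -> 'cV[R]_m -> 'cV[R]_n) (U : set 'cV[R]_m)
    (Omega : set 'cV[R]_n) (L : 'cV[R]_n -> 'cV[R]_m -> R)
    (q : 'cV[R]_n -> R) (Tmin eps rho t : R) (y : 'cV[R]_n)
    (T : R) (u : R -> 'cV[R]_m) (x : R -> 'cV[R]_n) : Prop :=
  [/\ Tmin <= T, admissible f U Omega t T y u, trajectory f t (t + T) y u x &
      forall T' u' x', Tmin <= T' -> admissible f U Omega t T' y u' ->
        trajectory f t (t + T') y u' x' ->
        cost L q eps rho t T u x <= cost L q eps rho t T' u' x'].

Definition sample (R : realType) (delta : R) (i : nat) : R := i%:R * delta.

(* The state is concatenated on the closed intervals [t_i, t_(i+1)], so that
   the state xs (t_(i+1)) measured at the next sampling time, which is the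
   initial state of the next problem, is the end point of the piece x i. *)
Definition closed_loop (R : realType) (n m : nat)
    (f : 'cV[R]_n -> 'cV[R]_m -> 'cV[R]_n) (U : set 'cV[R]_m)
    (Omega : set 'cV[R]_n) (L : 'cV[R]_n -> 'cV[R]_m -> R)
    (q : 'cV[R]_n -> R) (Tmin delta : R) (eps rho : nat -> R) (x0 : 'cV[R]_n)
    (T : nat -> R) (u : nat -> R -> 'cV[R]_m) (x : nat -> R -> 'cV[R]_n)
    (us : R -> 'cV[R]_m) (xs : R -> 'cV[R]_n) : Prop :=
  let t := sample delta in
  [/\ xs 0 = x0,
      forall i, solves_P f U Omega L q Tmin (eps i) (rho i) (t i) (xs (t i))
        (T i) (u i) (x i),
      forall i s, s \in `[t i, t i.+1] -> xs s = x i s &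
      forall i s, s \in `[t i, t i.+1[ -> us s = u i s].

(* As the control is piecewise continuous, q along the trajectory has a
   derivative except at finitely many times. *)
Definition local_decrease (R : realType) (n m : nat)
    (f : 'cV[R]_n -> 'cV[R]_m -> 'cV[R]_n) (U : set 'cV[R]_m)
    (Omega : set 'cV[R]_n) (L : 'cV[R]_n -> 'cV[R]_m -> R)
    (q : 'cV[R]_n -> R) (delta : R) (y : 'cV[R]_n)
    (u : R -> 'cV[R]_m) (x : R -> 'cV[R]_n) : Prop :=
  [/\ piecewise_continuous 0 delta u,
      forall s, s \in `[0, delta] -> U (u s),
      trajectory f 0 delta y u x,
      forall s, s \in `[0, delta] -> Omega (x s) &
      exists D : seq R, forall s, s \in `]0, delta[ -> s \notin D ->
        derivable (q \o x) s 1 /\ derive1 (q \o x) s + L (x s) (u s) <= 0].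

(* Main.v *)
Require Import Defs.
From HB Require Import structures.
From mathcomp Require Import all_boot all_order all_algebra.
From mathcomp Require Import all_classical all_reals all_analysis.
Set Implicit Arguments.
Unset Strict Implicit.
Unset Printing Implicit Defensive.
From mathcomp Require Import ring lra.
Import Order.TTheory GRing.Theory Num.Theory.
Import numFieldNormedType.Exports.
Local Open Scope classical_set_scope.
Local Open Scope ring_scope.

(** The optimal cost V_i of the i-th problem is a Lyapunov function of the
    closed loop. A competitor for the next problem is obtained from the current
    solution by dropping its first sampling interval; when this would leave a
    horizon shorter than Tmin, the competitor is prolonged inside Omega by the
    local control, which does not raise the cost since q pays for the running
    cost there and eps_i <= 1 <= rho_i. The conditions on the weights are
    exactly what makes this competitor cost at most
    V_i - xi * eps_i * I_i, where I_i is the integral of L over the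
    i-th sampling interval ([value_decrease]). As V_i is nonnegative and eps_i
    is eventually bounded away from 0, the sequence I_i tends to 0.

    It remains to turn small integrals into small states. The right-hand side
    grows at most linearly in the state, uniformly over the control box, so a
    state of norm at least eta at some time forces the norm to be at least
    eta / 4 on a surrounding time interval whose length is the same for all
    times and all stages ([norm_comparison]). Such an interval fits into the sampling interval that
    contains this time, hence I_i is bounded below by a positive constant
    ([stage_cost_lower_bound]). So large states occur in finitely many sampling
    intervals only, without any a priori bound on the closed-loop trajectory.

    Controls are piecewise continuous, so all trajectories are differentiable
    up to finitely many times; the mean value inequality [increment_le], which
    tolerates such exceptions, carries the growth estimate, the uniqueness of
    trajectories and the decrease of q along the local control. Uniqueness is
    needed because admissibility only asserts that some trajectory of the
    control ends in Omega. *)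

(** * Mean value inequalities with finitely many exceptional times *)

(** Splitting the interval at an exceptional time lowers the number of
    exceptions by one; without exceptions this is the mean value theorem. *)
Lemma increment_le (R : realType) (g : R -> R) (C : R) (D : seq R) (a b : R) :
  a <= b -> {within `[a, b], continuous g} ->
  (forall s, s \in `]a, b[ -> s \notin D ->
     exists2 l, is_derive s 1 g l & l <= C) ->
  g b - g a <= C * (b - a).
Proof.
elim: D a b => [|d D IH] a b ab gc gd.
  move: ab; rewrite le_eqVlt => /predU1P[<-|ab]; first by rewrite !subrr mulr0.
  have gder s : s \in `]a, b[ -> is_derive s 1 g ('D_1 g s) /\ 'D_1 g s <= C.
    by move=> /gd /(_ isT) [l gl lC]; rewrite derive_val.
  have [c cab ->] := MVT ab (fun s sab => (gder s sab).1) gc.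
  by rewrite ler_wpM2r ?subr_ge0 ?(ltW ab)//; exact: (gder c cab).2.
have [dab|dab] := boolP (d \in `]a, b[); last first.
  apply: IH => // s sab sD; apply: gd => //; rewrite inE negb_or sD andbT.
  by apply: contraNneq dab => <-.
have /andP[ad db] : a < d < b by rewrite in_itv in dab.
have -> : g b - g a = (g b - g d) + (g d - g a) by rewrite addrA subrK.
have -> : C * (b - a) = C * (b - d) + C * (d - a) by rewrite -mulrDr addrA subrK.
apply: lerD; apply: IH; rewrite ?(ltW ad) ?(ltW db)//.
- apply: continuous_subspaceW gc => s /=; rewrite !in_itv/= => /andP[ds ->].
  by rewrite (le_trans (ltW ad)).
- move=> s; rewrite in_itv/= => /andP[ds sb] sD; apply: gd.
    by rewrite in_itv/= sb (lt_trans ad).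
  by rewrite inE negb_or sD andbT gt_eqF.
- apply: continuous_subspaceW gc => s /=; rewrite !in_itv/= => /andP[-> sd].
  by rewrite (le_trans sd (ltW db)).
- move=> s; rewrite in_itv/= => /andP[ls sd] sD; apply: gd.
    by rewrite in_itv/= ls (lt_trans sd).
  by rewrite inE negb_or sD andbT lt_eqF.
Qed.

Lemma norm_coord_le (R : realType) (n : nat) (v : 'cV[R]_n) i : `|v i 0| <= `|v|.
Proof.
rewrite [leRHS]/Num.norm /= mx_normrE; apply/bigmax_geP; right => /=.
by exists (i, 0).
Qed.

Lemma norm_col_le (R : realType) (n : nat) (v : 'cV[R]_n) (C : R) :
  0 <= C -> (forall i, `|v i 0| <= C) -> `|v| <= C.
Proof.
move=> C0 vC; rewrite [leLHS]/Num.norm /= mx_normrE; apply/bigmax_leP; split=> //.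
by move=> [i j] _ /=; rewrite ord1; exact: vC.
Qed.

Lemma within_continuous_coord (R : realType) (n : nat) (z : R -> 'cV[R]_n)
    (A : set R) (i : 'I_n) :
  {within A, continuous z} -> {within A, continuous (fun s => z s i 0)}.
Proof.
move=> zc s; apply: (@continuous_comp (subspace A) _ _ z (fun M : 'cV[R]_n => M i 0)).
  exact: zc.
exact: coord_continuous.
Qed.

Lemma is_derive_coord (R : realType) (n : nat) (z : R -> 'cV[R]_n) (s : R)
    (l : 'cV[R]_n) (i : 'I_n) :
  is_derive s 1 z l -> is_derive s 1 (fun r => z r i 0) (l i 0).
Proof.
move=> zl; have zd : derivable z s 1 by [].
have zid : derivable (fun r => z r i 0) s 1.
  exact: (derivable_mxP z s 1).1 zd i 0.
apply: (is_derive_eq (derivableP zid)).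
by have := derive_mx zd; rewrite derive_val => ->; rewrite mxE.
Qed.

(** The norm of column vectors is the sup norm, so the scalar inequality applied
    to each coordinate and to its opposite loses no constant. *)
Lemma norm_increment_le (R : realType) (n : nat) (z : R -> 'cV[R]_n) (C : R)
    (D : seq R) (a b : R) :
  0 <= C -> a <= b -> {within `[a, b], continuous z} ->
  (forall s, s \in `]a, b[ -> s \notin D ->
     exists2 l, is_derive s 1 z l & `|l| <= C) ->
  `|z b - z a| <= C * (b - a).
Proof.
move=> C0 ab zc zd; apply: norm_col_le => [|i].
  by rewrite mulr_ge0// subr_ge0.
have zic := within_continuous_coord (i := i) zc.
rewrite !mxE ler_norml; apply/andP; split.
  rewrite -[leRHS]opprK lerN2.
  have -> : - (z b i 0 - z a i 0) = (- z b i 0) - (- z a i 0).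
    by rewrite opprB opprK addrC.
  apply: (@increment_le _ (fun s => - z s i 0) _ D _ _ ab).
    by move=> s; apply: continuousN; exact: zic.
  move=> s sab sD; have [l zl lC] := zd s sab sD; exists (- l i 0).
    by apply: is_deriveN; exact: is_derive_coord.
  by rewrite lerNl; have := le_trans (norm_coord_le l i) lC; rewrite ler_norml => /andP[].
apply: (@increment_le _ (fun s => z s i 0) _ D _ _ ab zic).
move=> s sab sD; have [l zl lC] := zd s sab sD; exists (l i 0).
  exact: is_derive_coord.
exact: le_trans (ler_norm _) (le_trans (norm_coord_le l i) lC).
Qed.

Lemma within_continuous_norm (R : realType) (V : normedModType R) (z : R -> V)
    (A : set R) :
  {within A, continuous z} -> {within A, continuous (fun s => `|z s|)}.
Proof.
move=> zc s; apply: (@continuous_comp (subspace A) _ _ z (fun v : V => `|v|)).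
  exact: zc.
exact: norm_continuous.
Qed.

(** A substitute for the Gronwall inequality on intervals of length at most
    1 / (2 K): the variation of z is at most (K N + M) (b - a), where N is the
    maximum of the norm, and K N (b - a) <= N / 2 is absorbed by N. Since s and
    t can be in any order, this also bounds the norm from below around a time
    where it is large. *)
Lemma norm_comparison (R : realType) (n : nat) (z : R -> 'cV[R]_n) (K M : R)
    (D : seq R) (a b s t : R) :
  0 <= K -> 0 <= M -> K * (b - a) <= 2^-1 ->
  {within `[a, b], continuous z} ->
  (forall r, r \in `]a, b[ -> r \notin D ->
     exists2 l, is_derive r 1 z l & `|l| <= K * `|z r| + M) ->
  s \in `[a, b] -> t \in `[a, b] -> `|z t| <= 2 * (`|z s| + M * (b - a)).
Proof.
move=> K0 M0 Kab zc zd sab tab.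
have ab : a <= b by move: sab; rewrite in_itv/= => /andP[]; exact: le_trans.
have [r rab zr] := EVT_max ab (within_continuous_norm zc).
pose C := K * `|z r| + M.
have C0 : 0 <= C by rewrite addr_ge0// mulr_ge0.
have incr p p' : p \in `[a, b] -> p' \in `[a, b] -> p <= p' ->
    `|z p' - z p| <= C * (b - a).
  rewrite !in_itv/= => /andP[ap pb] /andP[ap' p'b] pp'.
  apply: le_trans (_ : C * (p' - p) <= _); last by rewrite ler_wpM2l// lerB.
  apply: (@norm_increment_le _ _ _ _ D) => //.
    apply: continuous_subspaceW zc => w /=; rewrite !in_itv/= => /andP[pw wp'].
    by rewrite (le_trans ap pw) (le_trans wp' p'b).
  move=> w; rewrite in_itv/= => /andP[pw wp'] wD.
  have wab : w \in `]a, b[ by rewrite in_itv/= (le_lt_trans ap pw) (lt_le_trans wp' p'b).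
  have [l zl lw] := zd w wab wD; exists l => //; apply: le_trans lw _.
  rewrite /C lerD2r ler_wpM2l// zr//.
  by move: wab; rewrite !in_itv/= => /andP[/ltW -> /ltW ->].
have zrs : `|z r - z s| <= C * (b - a).
  have [rs|/ltW sr] := leP r s; last exact: incr.
  by rewrite distrC; exact: incr.
have zrle : `|z r| <= `|z s| + C * (b - a).
  by rewrite -[z r](subrK (z s)) addrC (le_trans (ler_normD _ _))// lerD2l.
have : C * (b - a) <= 2^-1 * `|z r| + M * (b - a).
  by rewrite /C mulrDl lerD2r mulrAC ler_wpM2r.
have := zr t tab; lra.
Qed.

(** * Trajectories *)

Lemma trajectory_sub (R : realType) (n m : nat)
    (f : 'cV[R]_n -> 'cV[R]_m -> 'cV[R]_n) (a b a' b' : R) (y : 'cV[R]_n)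
    (u : R -> 'cV[R]_m) (x : R -> 'cV[R]_n) :
  a <= a' -> b' <= b -> trajectory f a b y u x -> trajectory f a' b' (x a') u x.
Proof.
move=> aa' b'b [xc _ [D xd]]; split => //.
  apply: continuous_subspaceW xc => w /=; rewrite !in_itv/= => /andP[pw wp'].
  by rewrite (le_trans aa' pw) (le_trans wp' b'b).
exists D => s; rewrite in_itv/= => /andP[a's sb'] sD; apply: xd => //.
by rewrite in_itv/= (le_lt_trans aa' a's) (lt_le_trans sb' b'b).
Qed.

(** The difference z of two trajectories satisfies |z'| <= K |z|. By
    [norm_comparison] with M = 0, it stays 0 for a time 1 / (2 K) once it
    vanishes, and finitely many such steps cover the interval. *)
Lemma trajectory_unique (R : realType) (n m : nat)
    (f : 'cV[R]_n -> 'cV[R]_m -> 'cV[R]_n) (K a b : R) (y : 'cV[R]_n)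
    (u : R -> 'cV[R]_m) (x x' : R -> 'cV[R]_n) :
  (forall v, K.-lipschitz (f ^~ v)) ->
  trajectory f a b y u x -> trajectory f a b y u x' ->
  forall s, s \in `[a, b] -> x s = x' s.
Proof.
move=> flip [xc xa [D xd]] [x'c x'a [D' x'd]].
(* K can be nonpositive *)
pose K1 := `|K| + 1; have K1_gt0 : 0 < K1 by rewrite ltr_wpDl.
pose tau := (2 * K1)^-1; have tau_gt0 : 0 < tau by rewrite invr_gt0 mulr_gt0.
have K1tau : K1 * tau = 2^-1.
  by rewrite /tau invfM mulrCA mulfV ?mulr1// gt_eqF.
have step c s : a <= c -> c <= s -> s <= b -> s - c <= tau -> x c = x' c ->
    x s = x' s.
  move=> ac cs sb sctau xx'; apply/eqP; rewrite -subr_eq0 -normr_le0.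
  have -> : 0 = 2 * (`|x c - x' c| + 0 * (s - c)) :> R.
    by rewrite xx' subrr normr0 mul0r addr0 mulr0.
  have sub w : c <= w <= s -> a <= w <= b.
    by move=> /andP[cw ws]; rewrite (le_trans ac cw) (le_trans ws sb).
  apply: (@norm_comparison _ _ (fun w => x w - x' w) K1 0 (D ++ D') c s c s).
  - exact: ltW.
  - by [].
  - by rewrite -K1tau ler_wpM2l// ltW.
  - have xc' : {within `[c, s], continuous x}.
      by apply: continuous_subspaceW xc => w /=; rewrite !in_itv/=; exact: sub.
    have x'c' : {within `[c, s], continuous x'}.
      by apply: continuous_subspaceW x'c => w /=; rewrite !in_itv/=; exact: sub.
    by move=> w; apply: continuousB; [exact: xc'|exact: x'c'].
  - move=> r; rewrite in_itv/= mem_cat negb_or => /andP[cr rs] /andP[rD rD'].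
    have rab : r \in `]a, b[.
      by rewrite in_itv/= (le_lt_trans ac cr) (lt_le_trans rs sb).
    exists (f (x r) (u r) - f (x' r) (u r)).
      by apply: is_deriveB; [exact: xd|exact: x'd].
    rewrite addr0; apply: le_trans (flip (u r) (x r, x' r) _) _ => //=.
    by rewrite ler_wpM2r// (le_trans (ler_norm K))// lerDl.
  - by rewrite in_itv/= lexx.
  - by rewrite in_itv/= cs lexx.
have ind k s : s \in `[a, b] -> s <= a + k%:R * tau -> x s = x' s.
  elim: k s => [|k IH] s; rewrite in_itv/= => /andP[las sb].
    rewrite mul0r addr0 => sa; have -> : s = a by apply/le_anti/andP.
    by rewrite xa x'a.
  rewrite -natr1 mulrDl mul1r addrA => sk.
  have [sk'|/ltW sk'] := leP s (a + k%:R * tau).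
    by apply: IH => //; rewrite in_itv/= las.
  have ak : a <= a + k%:R * tau by rewrite lerDl mulr_ge0// ltW.
  apply: (step (a + k%:R * tau)) => //; first by rewrite lerBlDl.
  by apply: IH => //; rewrite in_itv/= ak (le_trans sk').
move=> s sab; have [k sk] : exists k : nat, (s - a) / tau < k%:R.
  exists (Num.bound ((s - a) / tau)); apply: archi_boundP.
  apply: divr_ge0; last exact: ltW.
  by move: sab; rewrite in_itv/= => /andP[las _]; rewrite subr_ge0.
by apply: (ind k) => //; rewrite -lerBlDl -ler_pdivrMr// ltW.
Qed.

(** * Bounds on compact sets *)

Lemma trmx_continuous (R : realType) (m n : nat) :
  continuous (@trmx R m n).
Proof.
move=> M s /nbhs_ballP [e e0 es]; apply/nbhs_ballP; exists e => //= N [_ MN].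
by apply: es; split => // i j; rewrite !mxE; exact: MN.
Qed.

(** Tychonoff for row vectors, transported by transposition. *)
Lemma compact_control_box (R : realType) (m : nat) (umin umax : 'cV[R]_m) :
  compact (control_box umin umax).
Proof.
have -> : control_box umin umax = trmx @`
    [set v : 'rV[R]_m | forall j, [set` `[umin j 0, umax j 0]] (v ord0 j)].
  apply/seteqP; split => [v vU|_ [w wU <-] j].
    exists v^T; last by rewrite trmxK.
    by move=> j; rewrite /= in_itv/= mxE; exact: vU.
  by rewrite mxE; have := wU j; rewrite /= in_itv.
apply: continuous_compact.
  by apply: continuous_subspaceT; exact: trmx_continuous.
apply: (@rV_compact _ _ (fun j => [set` `[umin j 0, umax j 0]])) => j.
exact: segment_compact.
Qed.

Lemma compact_norm_bounded (R : realType) (V : normedModType R) (A : set V) :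
  compact A -> exists B, forall v, A v -> `|v| <= B.
Proof.
by move=> /compact_bounded /pinfty_ex_gt0 [B _ AB]; exists B.
Qed.

(** In the sup norm a ball is itself a box, so both factors are compact. *)
Lemma bounded_on_ball_box (R : realType) (n m : nat) (W : normedModType R)
    (F : 'cV[R]_n * 'cV[R]_m -> W) (umin umax : 'cV[R]_m) (r : R) :
  continuous F ->
  exists B, forall z v, `|z| <= r -> control_box umin umax v -> `|F (z, v)| <= B.
Proof.
move=> Fc; pose A := control_box (const_mx (- r) : 'cV[R]_n) (const_mx r).
have /compact_norm_bounded [B AB] :
    compact (F @` (A `*` control_box umin umax)).
  apply: continuous_compact; first exact: continuous_subspaceT.
  by apply: compact_setX; exact: compact_control_box.
exists B => z v zr vU; apply: AB; exists (z, v) => //; split => // j /=.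
by rewrite !mxE -ler_norml (le_trans (norm_coord_le z j)).
Qed.

Lemma C1_continuous (R : realType) (V W : normedModType R) (F : V -> W) :
  C1 F -> continuous F.
Proof. by move=> [Fd _] z; exact: differentiable_continuous. Qed.

(** * The running cost along a controlled trajectory *)

Lemma continuous_at_interior (R : realType) (V : normedModType R) (z : R -> V)
    (a b s : R) :
  {within `[a, b], continuous z} -> s \in `]a, b[ -> {for s, continuous z}.
Proof.
move=> zc sab; have ab : a < b.
  by move: sab; rewrite in_itv/= => /andP[]; exact: lt_trans.
by have [zc' _ _] := (continuous_within_itvP z ab).1 zc; exact: zc'.
Qed.

(** Off the exceptional times and the end points the function is continuous on
    an open set; the remaining set is finite, so all its subsets are
    measurable. *)
Lemma measurable_fun_except_finite (R : realType) (g : R -> R) (D : seq R)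
    (a b : R) :
  (forall s, s \in `]a, b[ -> s \notin D -> {for s, continuous g}) ->
  measurable_fun `[a, b] g.
Proof.
move=> gc; pose E := [set` a :: b :: D].
have mE S : S `<=` E -> measurable S.
  move=> SE; apply: countable_measurable; first exact: measurable_set1.
  apply: sub_countable (subset_card_le SE) _.
  exact/finite_set_countable/finite_seq.
have -> : [set` `[a, b]] = (`]a, b[ `\` E) `|` (`[a, b] `&` E).
  apply/seteqP; split => s.
    have [sE|sE] := pselect (E s); first by right.
    move=> sab; left; split => //; move: sab sE; rewrite /E /= !in_itv/= !inE.
    move=> /andP[las lsb] /negP; rewrite !negb_or => /and3P[sa sb _].
    by rewrite lt_neqAle eq_sym sa las lt_neqAle sb lsb.
  by move=> [[]|[]//]; rewrite /= !in_itv/= => /andP[/ltW -> /ltW ->].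
apply/measurable_funU; [by apply: measurableD => //; exact: mE|exact: mE|split].
  apply: measurable_realfun.open_continuous_measurable_fun.
    rewrite setDE; apply: openI => //; rewrite openC.
    apply: compact_closed; first exact: Rhausdorff.
      exact/finite_compact/finite_seq.
  move=> s; rewrite inE => -[sab]; rewrite /E /= !inE => /negP.
  by rewrite !negb_or => /and3P[_ _ sD]; exact: gc.
by move=> _ Y mY; apply: mE => s [[]].
Qed.

Lemma continuous_pair_at (R : realType) (n m : nat) (W : normedModType R)
    (F : 'cV[R]_n -> 'cV[R]_m -> W) (x : R -> 'cV[R]_n) (u : R -> 'cV[R]_m) s :
  continuous (fun z : 'cV[R]_n * 'cV[R]_m => F z.1 z.2) ->
  {for s, continuous x} -> {for s, continuous u} ->
  {for s, continuous (fun r => F (x r) (u r))}.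
Proof.
move=> Fc xc uc.
apply: (@continuous_comp _ _ _ (fun r => (x r, u r)) (fun z => F z.1 z.2)).
  exact: (cvg_pair xc uc).
exact: Fc.
Qed.

(** The state is bounded on the compact interval and the control takes values
    in a box, so the integrand is bounded. *)
Lemma running_cost_integrable (R : realType) (n m : nat)
    (L : 'cV[R]_n -> 'cV[R]_m -> R) (umin umax : 'cV[R]_m) (a b : R)
    (u : R -> 'cV[R]_m) (x : R -> 'cV[R]_n) :
  continuous (fun z : 'cV[R]_n * 'cV[R]_m => L z.1 z.2) -> {within `[a, b], continuous x} ->
  piecewise_continuous a b u ->
  (forall s, s \in `[a, b] -> control_box umin umax (u s)) ->
  lebesgue_measure.-integrable `[a, b] (EFin \o (fun s => L (x s) (u s))).
Proof.
move=> Lc xc [[D uc] _ _] uU; apply: measurable_bounded_integrable.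
- exact: measurable_itv.
- exact/compact_finite_measure/segment_compact.
- apply: (@measurable_fun_except_finite R (fun s => L (x s) (u s)) D a b).
  move=> s sab sD.
  exact: (continuous_pair_at Lc (continuous_at_interior xc sab) (uc s sab sD)).
- have [r xr] : exists r, forall v, (x @` `[a, b]) v -> `|v| <= r.
    apply: compact_norm_bounded; apply: continuous_compact => //.
    exact: segment_compact.
  have [B LB] := bounded_on_ball_box umin umax r Lc.
  apply: filterS (nbhs_pinfty_ge (num_real B)) => M BM s sab /=.
  apply: le_trans BM; apply: (LB (x s) (u s)); last exact: uU.
  by apply: xr; exists s.
Qed.

Lemma integrable_subitv (R : realType) (g : R -> R) (a b c d : R) :
  a <= c -> d <= b ->
  lebesgue_measure.-integrable `[a, b] (EFin \o g) ->
  lebesgue_measure.-integrable `[c, d] (EFin \o g).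
Proof.
move=> ac db; apply: integrableS => // s /=; rewrite !in_itv/= => /andP[cs sd].
by rewrite (le_trans ac cs) (le_trans sd db).
Qed.

Lemma int_cost_split (R : realType) (n m : nat)
    (L : 'cV[R]_n -> 'cV[R]_m -> R) (x : R -> 'cV[R]_n) (u : R -> 'cV[R]_m)
    (a b c : R) :
  lebesgue_measure.-integrable `[a, c] (EFin \o (fun s => L (x s) (u s))) ->
  a <= b -> b <= c ->
  int_cost L x u a c = int_cost L x u a b + int_cost L x u b c.
Proof.
move=> Li ab bc; rewrite /int_cost.
rewrite -[X in _ = _ + X]Rintegral_itv_obnd_cbnd; last first.
  apply: integrableS Li => // s /=; rewrite !in_itv/= => /andP[bs ->].
  by rewrite (le_trans ab (ltW bs)).
by rewrite -(Rintegral_itvB Li) ?bnd_simp// addrC subrK.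
Qed.

(** The integral form of the local decrease condition: the sum of q along the
    trajectory and of the cost accumulated so far is continuous and, by the
    fundamental theorem of calculus, has a nonpositive derivative except at
    finitely many times. *)
Lemma terminal_cost_decrease (R : realType) (n m : nat)
    (L : 'cV[R]_n -> 'cV[R]_m -> R) (q : 'cV[R]_n -> R)
    (umin umax : 'cV[R]_m) (a b : R) (u : R -> 'cV[R]_m) (x : R -> 'cV[R]_n)
    (D : seq R) :
  continuous (fun z : 'cV[R]_n * 'cV[R]_m => L z.1 z.2) -> continuous q ->
  a <= b -> piecewise_continuous a b u ->
  (forall s, s \in `[a, b] -> control_box umin umax (u s)) ->
  {within `[a, b], continuous x} ->
  (forall s, s \in `]a, b[ -> s \notin D ->
     derivable (q \o x) s 1 /\ derive1 (q \o x) s + L (x s) (u s) <= 0) ->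
  int_cost L x u a b + q (x b) <= q (x a).
Proof.
move=> Lc qc ab upc uU xc qd.
have Li := running_cost_integrable Lc xc upc uU.
have [[Du uc] _ _] := upc.
pose G s := int_cost L x u a s + q (x s).
have Gc : {within `[a, b], continuous G}.
  move=> s; apply: continuousD.
    exact: (parameterized_integral_continuous ab Li).
  by apply: (@continuous_comp (subspace `[a, b]) _ _ x q); [exact: xc|exact: qc].
have : G b - G a <= 0 * (b - a).
  apply: (@increment_le _ G 0 (D ++ Du)) => // s sab.
  rewrite mem_cat negb_or => /andP[sD sDu].
  have /andP[ls ls'] : a < s < b by rewrite in_itv in sab.
  have [qxd qxL] := qd s sab sD.
  have Lcs := continuous_pair_at Lc (continuous_at_interior xc sab) (uc s sab sDu).
  have [Fd Fe] := continuous_FTC1_closed ls' Li ls Lcs.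
  exists (L (x s) (u s) + derive1 (q \o x) s); last by rewrite addrC.
  apply: is_deriveD.
    by rewrite -Fe derive1E; exact: (derivableP Fd).
  by rewrite derive1E; exact: (derivableP qxd).
by rewrite /G {2}/int_cost set_itv1 Rintegral_set1 add0r mul0r subr_le0.
Qed.

(** * Restriction, concatenation and time shift *)

Lemma piecewise_continuous_sub (R : realType) (V : normedModType R)
    (a b a' b' : R) (u : R -> V) :
  a <= a' -> b' <= b -> piecewise_continuous a b u ->
  piecewise_continuous a' b' u.
Proof.
move=> aa' b'b [[D uc] ur ul]; split.
- exists D => s; rewrite in_itv/= => /andP[a's sb']; apply: uc.
  by rewrite in_itv/= (le_lt_trans aa' a's) (lt_le_trans sb' b'b).
- move=> s; rewrite in_itv/= => /andP[a's sb']; apply: ur.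
  by rewrite in_itv/= (le_trans aa' a's) (lt_le_trans sb' b'b).
- move=> s; rewrite in_itv/= => /andP[a's sb']; apply: ul.
  by rewrite in_itv/= (le_lt_trans aa' a's) (le_trans sb' b'b).
Qed.

(** Which function supplies the value at the switching time c does not matter:
    concatenated states agree there, and a control is relevant only up to its
    values at finitely many times. *)
Definition concat (R : realType) (V : Type) (c : R) (g h : R -> V) (s : R) : V :=
  if s < c then g s else h s.

Lemma concat_lt (R : realType) (V : Type) (c s : R) (g h : R -> V) :
  s < c -> concat c g h s = g s.
Proof. by rewrite /concat => ->. Qed.

Lemma concat_ge (R : realType) (V : Type) (c s : R) (g h : R -> V) :
  c <= s -> concat c g h s = h s.
Proof. by rewrite /concat ltNge => ->. Qed.

Lemma is_cvg_near_eq (R : realType) (V : normedModType R) (F : set_system R)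
    (FF : Filter F) (g h : R -> V) :
  (\forall s \near F, g s = h s) -> cvg (g @ F) -> cvg (h @ F).
Proof.
move=> gh /cvg_ex [l gl]; apply/cvg_ex; exists l.
by apply: cvg_trans gl; apply: near_eq_cvg; apply: filterS gh.
Qed.

Lemma piecewise_continuous_concat (R : realType) (V : normedModType R)
    (a b c : R) (g h : R -> V) :
  piecewise_continuous a c g -> piecewise_continuous c b h ->
  piecewise_continuous a b (concat c g h).
Proof.
move=> [[D gc] gr gl] [[E hc] hr hl]; split.
- exists (c :: D ++ E) => s; rewrite in_itv/= => /andP[ls sb].
  rewrite inE mem_cat !negb_or => /and3P[sc sD sE].
  have [ltsc|] := ltP s c.
    have gs : {for s, continuous g} by apply: gc => //; rewrite in_itv/= ls.
    rewrite /prop_for /continuous_at concat_lt//; apply: cvg_trans gs.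
    apply: near_eq_cvg; near=> r; rewrite concat_lt//; near: r.
    exact: lt_nbhsl.
  rewrite le_eqVlt eq_sym (negPf sc)/= => cs.
  have hs : {for s, continuous h} by apply: hc => //; rewrite in_itv/= cs.
  rewrite /prop_for /continuous_at concat_ge ?(ltW cs)//; apply: cvg_trans hs.
  apply: near_eq_cvg; near=> r; rewrite concat_ge//; apply: ltW; near: r.
  exact: lt_nbhsr.
- move=> s; rewrite in_itv/= => /andP[ls sb]; have [sc|cs] := ltP s c.
    apply: is_cvg_near_eq (gr s _); last by rewrite in_itv/= ls.
    by near=> r; rewrite concat_lt//; near: r; exact: nbhs_right_lt.
  apply: is_cvg_near_eq (hr s _); last by rewrite in_itv/= cs.
  by apply: filterS (nbhs_right_gt s) => r sr; rewrite concat_ge// (le_trans cs)// ltW.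
- move=> s; rewrite in_itv/= => /andP[ls sb]; have [sc|cs] := leP s c.
    apply: is_cvg_near_eq (gl s _); last by rewrite in_itv/= ls.
    by apply: filterS (nbhs_left_lt s) => r rs; rewrite concat_lt// (lt_le_trans rs).
  apply: is_cvg_near_eq (hl s _); last by rewrite in_itv/= cs.
  by near=> r; rewrite concat_ge//; near: r; exact: nbhs_left_ge.
Unshelve. all: by end_near. Qed.

Lemma trajectory_concat (R : realType) (n m : nat)
    (f : 'cV[R]_n -> 'cV[R]_m -> 'cV[R]_n) (a b c : R) (y : 'cV[R]_n)
    (u1 u2 : R -> 'cV[R]_m) (x1 x2 : R -> 'cV[R]_n) :
  a <= c -> c <= b ->
  trajectory f a c y u1 x1 -> trajectory f c b (x1 c) u2 x2 ->
  trajectory f a b y (concat c u1 u2) (concat c x1 x2).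
Proof.
move=> ac cb [x1c x1a [D x1d]] [x2c x2c0 [E x2d]]; split.
- have -> : [set` `[a, b]] = `[a, c] `|` `[c, b].
    apply/seteqP; split => s /=; rewrite !in_itv/=.
      by move=> /andP[-> ->]; case/orP: (le_total s c) => ->; [left|right].
    by move=> [/andP[-> sc]|/andP[cs ->]]; rewrite ?(le_trans sc)// (le_trans ac).
  apply: withinU_continuous; [exact: interval_closed|exact: interval_closed| |].
    apply: subspace_eq_continuous x1c => s; rewrite inE /= in_itv/= => /andP[_].
    rewrite /from_subspace le_eqVlt => /predU1P[->|sc]; first by rewrite concat_ge.
    by rewrite concat_lt.
  apply: subspace_eq_continuous x2c => s; rewrite inE /= in_itv/= => /andP[cs _].
  by rewrite /from_subspace concat_ge.
- move: ac; rewrite le_eqVlt => /predU1P[eac|ac]; last by rewrite concat_lt.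
  by rewrite eac concat_ge// x2c0 -eac.
- exists (c :: D ++ E) => s; rewrite in_itv/= => /andP[ls sb].
  rewrite inE mem_cat !negb_or => /and3P[sc sD sE].
  have [ltsc|] := ltP s c.
    rewrite !concat_lt//; apply: near_eq_is_derive (x1d s _ sD).
      by near=> r; rewrite concat_lt//; near: r; exact: lt_nbhsl.
    by rewrite in_itv/= ls.
  rewrite le_eqVlt eq_sym (negPf sc)/= => cs.
  rewrite !concat_ge ?(ltW cs)//; apply: near_eq_is_derive (x2d s _ sE).
    by near=> r; rewrite concat_ge//; apply: ltW; near: r; exact: lt_nbhsr.
  by rewrite in_itv/= cs.
Unshelve. all: by end_near. Qed.

(** With A and B intervals or half-lines this covers one-sided limits and
    continuity on an interval at once. *)
Lemma shift_cvg_within (R : realType) (c s : R) (A B : set R) :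
  (forall r, A r -> B (r - c)) ->
  (r - c) @[r --> within A (nbhs s)] --> within B (nbhs (s - c)).
Proof.
move=> AB S BS.
have sc : (r - c) @[r --> s] --> s - c by apply: cvgB; [exact: cvg_id|exact: cvg_cst].
have BSs : \forall r \near s, B (r - c) -> S (r - c) by exact: sc _ BS.
rewrite /nbhs/= /within/=; apply: filterS BSs => r BSr Ar.
exact/BSr/AB.
Qed.

Lemma piecewise_continuous_shift (R : realType) (V : normedModType R)
    (a b c : R) (u : R -> V) :
  piecewise_continuous a b u ->
  piecewise_continuous (a + c) (b + c) (fun s => u (s - c)).
Proof.
move=> [[D uc] ur ul]; split.
- exists [seq d + c | d <- D] => s; rewrite in_itv/= => /andP[ls sb] sD.
  have sc : (r - c) @[r --> s] --> s - c by apply: cvgB; [exact: cvg_id|exact: cvg_cst].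
  apply: cvg_comp sc _; apply: uc.
    by rewrite in_itv/= ltrBrDr ls ltrBlDr.
  by apply: contra sD => sD; apply/mapP; exists (s - c) => //; rewrite subrK.
- move=> s; rewrite in_itv/= => /andP[ls sb].
  have /cvg_ex [l ul'] : cvg (u r @[r --> (s - c)^'+]).
    by apply: ur; rewrite in_itv/= lerBrDr ls ltrBlDr.
  apply/cvg_ex; exists l; apply: cvg_comp ul'.
  by apply: shift_cvg_within => r; rewrite ltrD2r.
- move=> s; rewrite in_itv/= => /andP[ls sb].
  have /cvg_ex [l ul'] : cvg (u r @[r --> (s - c)^'-]).
    by apply: ul; rewrite in_itv/= ltrBrDr ls lerBlDr.
  apply/cvg_ex; exists l; apply: cvg_comp ul'.
  by apply: shift_cvg_within => r; rewrite ltrD2r.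
Qed.

Lemma within_continuous_shift (R : realType) (V : normedModType R)
    (a b c : R) (z : R -> V) :
  {within `[a, b], continuous z} ->
  {within `[a + c, b + c], continuous (fun s => z (s - c))}.
Proof.
move=> /subspace_continuousP zc; apply/subspace_continuousP => s.
rewrite /= in_itv/= => /andP[ls sb].
have : [set` `[a, b]] (s - c) by rewrite /= in_itv/= lerBrDr ls lerBlDr.
move=> /zc; apply: cvg_comp; apply: shift_cvg_within => r /=.
by rewrite !in_itv/= lerBrDr lerBlDr.
Qed.

(** The difference quotients are the same. *)
Lemma is_derive_shift (R : realType) (V : normedModType R) (c s : R)
    (z : R -> V) (l : V) :
  is_derive (s - c) 1 z l -> is_derive s 1 (fun r => z (r - c)) l.
Proof.
move=> [zd zl].
have quot : (fun h => h^-1 *: (((fun r => z (r - c)) \o shift s) (h *: (1 : R)) - z (s - c)))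
    = (fun h => h^-1 *: ((z \o shift (s - c)) (h *: (1 : R)) - z (s - c))).
  by apply/funext => h /=; rewrite addrA.
split; first by rewrite /derivable quot.
by rewrite /derive quot.
Qed.

Lemma trajectory_shift (R : realType) (n m : nat)
    (f : 'cV[R]_n -> 'cV[R]_m -> 'cV[R]_n) (a b c : R) (y : 'cV[R]_n)
    (u : R -> 'cV[R]_m) (x : R -> 'cV[R]_n) :
  trajectory f a b y u x ->
  trajectory f (a + c) (b + c) y (fun s => u (s - c)) (fun s => x (s - c)).
Proof.
move=> [xc xa [D xd]]; split; first exact: within_continuous_shift.
  by rewrite addrK.
exists [seq d + c | d <- D] => s; rewrite in_itv/= => /andP[ls sb] sD.
apply: is_derive_shift; apply: xd.
  by rewrite in_itv/= ltrBrDr ls ltrBlDr.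
by apply: contra sD => sD; apply/mapP; exists (s - c) => //; rewrite subrK.
Qed.

(** * Decrease of the optimal cost *)

Lemma int_cost_ge0 (R : realType) (n m : nat) (L : 'cV[R]_n -> 'cV[R]_m -> R)
    (x : R -> 'cV[R]_n) (u : R -> 'cV[R]_m) (a b : R) :
  (forall z v, 0 <= L z v) -> 0 <= int_cost L x u a b.
Proof. by move=> L0; apply: Rintegral_ge0 => s _; exact: L0. Qed.

(** On the first interval the two integrands agree except at the end point c,
    where the concatenation already takes the value of the second pair. *)
Lemma int_cost_concat (R : realType) (n m : nat)
    (L : 'cV[R]_n -> 'cV[R]_m -> R) (x x' : R -> 'cV[R]_n)
    (u u' : R -> 'cV[R]_m) (a b c : R) :
  lebesgue_measure.-integrable `[a, c] (EFin \o (fun s => L (x s) (u s))) ->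
  lebesgue_measure.-integrable `[a, b]
    (EFin \o (fun s => L (concat c x x' s) (concat c u u' s))) ->
  a <= c -> c <= b ->
  int_cost L (concat c x x') (concat c u u') a b =
  int_cost L x u a c + int_cost L x' u' c b.
Proof.
move=> Li Lci ac cb; rewrite (int_cost_split Lci ac cb); congr (_ + _).
  rewrite /int_cost -Rintegral_itv_bndo_bndc; last first.
    apply: integrableS (integrable_subitv (lexx a) cb Lci) => // s /=.
    by rewrite !in_itv/= => /andP[-> /ltW].
  rewrite -Rintegral_itv_bndo_bndc; last first.
    apply: integrableS Li => // s /=.
    by rewrite !in_itv/= => /andP[-> /ltW].
  apply: eq_Rintegral => s; rewrite inE /= in_itv/= => /andP[_ sc].
  by rewrite !concat_lt.
apply: eq_Rintegral => s; rewrite inE /= in_itv/= => /andP[cs _].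
by rewrite !concat_ge.
Qed.

(** Admissibility asserts Omega for the end point of some trajectory; by
    uniqueness this is the given one. *)
Lemma admissible_terminal (R : realType) (n m : nat)
    (f : 'cV[R]_n -> 'cV[R]_m -> 'cV[R]_n) (U : set 'cV[R]_m)
    (Omega : set 'cV[R]_n) (K t T : R) (y : 'cV[R]_n) (u : R -> 'cV[R]_m)
    (x : R -> 'cV[R]_n) :
  (forall v, K.-lipschitz (f ^~ v)) -> 0 <= T ->
  admissible f U Omega t T y u -> trajectory f t (t + T) y u x ->
  Omega (x (t + T)).
Proof.
move=> flip T0 [_ _ [x' [x'u x'T]]] xu.
rewrite (trajectory_unique flip xu x'u)// in_itv/= lexx andbT.
by rewrite lerDl.
Qed.

(** The dynamic programming step. The solution of the next problem is compared
    with the tail of the current solution if the remaining horizon T - delta is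
    at least Tmin, and otherwise with this tail followed by the local control
    up to the horizon Tmin; the local control is used for a time
    Tmin + delta - T <= delta. *)
Lemma value_decrease (R : realType) (n m : nat)
    (f : 'cV[R]_n -> 'cV[R]_m -> 'cV[R]_n) (K : R) (umin umax : 'cV[R]_m)
    (Omega : set 'cV[R]_n) (L : 'cV[R]_n -> 'cV[R]_m -> R)
    (q : 'cV[R]_n -> R) (Tmin delta eps eps' rho rho' xi t T T' : R)
    (y : 'cV[R]_n) (u u' : R -> 'cV[R]_m) (x x' : R -> 'cV[R]_n)
    (us : 'cV[R]_n -> R -> 'cV[R]_m) (xs : 'cV[R]_n -> R -> 'cV[R]_n) :
  (forall v, K.-lipschitz (f ^~ v)) ->
  continuous (fun z : 'cV[R]_n * 'cV[R]_m => L z.1 z.2) -> continuous q ->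
  (forall z v, 0 <= L z v) -> 0 < delta -> delta <= Tmin ->
  eps <= 1 -> 1 <= rho ->
  (forall y, Omega y ->
     local_decrease f (control_box umin umax) Omega L q delta y (us y) (xs y)) ->
  solves_P f (control_box umin umax) Omega L q Tmin eps rho t y T u x ->
  solves_P f (control_box umin umax) Omega L q Tmin eps' rho' (t + delta)
    (x (t + delta)) T' u' x' ->
  (Tmin + delta <= T ->
     (eps' - eps) * int_cost L x u (t + delta) (t + T)
       + (rho' - rho) * q (x (t + T))
     <= delta + (1 - xi) * eps * int_cost L x u t (t + delta)) ->
  (Tmin <= T < Tmin + delta ->
     let u_s := fun s => us (x (t + T)) (s - (t + T)) in
     let x_s := fun s => xs (x (t + T)) (s - (t + T)) in
     (eps' - eps) * (int_cost L x u (t + delta) (t + T) +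
        int_cost L x_s u_s (t + T) (t + Tmin + delta))
     + (rho' - rho) * q (x_s (t + Tmin + delta))
     <= (T - Tmin) + (1 - xi) * eps * int_cost L x u t (t + delta)) ->
  cost L q eps' rho' (t + delta) T' u' x' <=
  cost L q eps rho t T u x - xi * (eps * int_cost L x u t (t + delta)).
Proof.
move=> flip Lc qc L0 delta0 deltaT eps1 rho1 us_dec [TminT uadm xu _]
  [_ _ _ u'opt] Hlong Hshort.
have T0 : 0 <= T by rewrite (le_trans _ TminT)// (le_trans _ deltaT)// ltW.
have yO := admissible_terminal flip T0 uadm xu.
have [upc uU _] := uadm; have [xc _ _] := xu.
have tdT : t + delta <= t + T by rewrite lerD2l (le_trans deltaT).
have ttd : t <= t + delta by rewrite lerDl ltW.
have Li := running_cost_integrable Lc xc upc uU.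
have xu_tail := trajectory_sub ttd (lexx _) xu.
have upc_tail := piecewise_continuous_sub ttd (lexx _) upc.
have uU_tail s : s \in `[t + delta, t + T] -> control_box umin umax (u s).
  rewrite in_itv/= => /andP[ts sT]; apply: uU.
  by rewrite in_itv/= sT (le_trans ttd).
rewrite {2}/cost (int_cost_split Li ttd tdT).
have [long|short] := leP (Tmin + delta) T.
  (* competitor: the tail of the current solution *)
  have e : t + delta + (T - delta) = t + T by ring.
  have := u'opt (T - delta) u x; rewrite /cost !e lerBrDr.
  move=> /(_ long) /(_ _ xu_tail) opt; have := Hlong long.
  have : admissible f (control_box umin umax) Omega (t + delta) (T - delta)
     (x (t + delta)) u.
    by rewrite /admissible e; split => //; exists x.
  by move=> /opt; rewrite /cost; lra.
have {Hshort} := Hshort; rewrite TminT short => /(_ isT) /=.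
set c := t + T; set us' := fun s => us _ (s - c).
set xs' := fun s => xs _ (s - c) => H3.
have e : t + Tmin + delta = t + delta + Tmin by ring.
rewrite e in H3; set b := t + delta + Tmin in H3.
have [us_pc us_U us_x xs_O [D xs_dec]] := us_dec _ yO.
have cb : c <= b by rewrite /c /b -addrA lerD2l addrC ltW.
have bdelta : b <= delta + c by rewrite /b /c; move: TminT; clear; lra.
have us'_pc : piecewise_continuous c b us'.
  apply: piecewise_continuous_sub (lexx c) bdelta _.
  by have := piecewise_continuous_shift c us_pc; rewrite add0r.
have us'_U s : s \in `[c, b] -> control_box umin umax (us' s).
  rewrite in_itv/= => /andP[cs sb]; apply: us_U.
  by rewrite in_itv/= subr_ge0 cs lerBlDr (le_trans sb).
have us'_x : trajectory f c b (x c) us' xs'.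
  have := trajectory_shift c us_x; rewrite add0r => us'_x.
  have := trajectory_sub (lexx c) bdelta us'_x.
  by have [_ -> _] := us'_x.
have xs'c : xs' c = x c by have [_ ? _] := us'_x.
(* competitor: the tail continued by the local control *)
pose uc := concat c u us'; pose xc' := concat c x xs'.
have xu_c : trajectory f (t + delta) b (x (t + delta)) uc xc'.
  exact: trajectory_concat xu_tail us'_x.
have uc_pc : piecewise_continuous (t + delta) b uc.
  exact: piecewise_continuous_concat.
have uc_U s : s \in `[t + delta, b] -> control_box umin umax (uc s).
  rewrite in_itv/= => /andP[ts sb]; have [sc|cs] := ltP s c.
    by rewrite /uc concat_lt//; apply: uU_tail; rewrite in_itv/= ts ltW.
  by rewrite /uc concat_ge//; apply: us'_U; rewrite in_itv/= cs.
have xc'b : xc' b = xs' b by rewrite /xc' concat_ge.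
have uc_adm : admissible f (control_box umin umax) Omega (t + delta) Tmin
    (x (t + delta)) uc.
  split => //; exists xc'; split => //; rewrite -/b xc'b; apply: xs_O.
  by rewrite in_itv/= subr_ge0 cb lerBlDr.
have := u'opt Tmin uc xc' (lexx _) uc_adm xu_c.
rewrite {2}/cost -/b xc'b.
have [xc'_c _ _] := xu_c.
have Lci := running_cost_integrable Lc xc'_c uc_pc uc_U.
rewrite int_cost_concat//; last exact: integrable_subitv ttd (lexx _) Li.
have dec : int_cost L xs' us' c b + q (xs' b) <= q (x c).
  rewrite -xs'c; have [xs'_c _ _] := us'_x.
  apply: (terminal_cost_decrease (D := [seq d + c | d <- D])
     Lc qc cb us'_pc us'_U xs'_c).
  move=> s; rewrite in_itv/= => /andP[cs sb] sD.
  have [qd qL] : derivable (q \o xs (x c)) (s - c) 1 /\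
     derive1 (q \o xs (x c)) (s - c) + L (xs' s) (us' s) <= 0.
    apply: xs_dec; first by rewrite in_itv/= subr_gt0 cs ltrBlDr (lt_le_trans sb).
    by apply: contra sD => sD; apply/mapP; exists (s - c) => //; rewrite subrK.
  have qs := is_derive_shift (derivableP qd).
  split; first exact: (@ex_derive _ _ _ _ _ _ _ qs).
  by rewrite derive1E (@derive_val _ _ _ _ _ _ _ qs) -derive1E.
have S0 := int_cost_ge0 xs' us' c b L0.
(* as eps <= 1 <= rho, the local running cost weighted by eps is paid for by
   the decrease of rho * q *)
have h1 : eps * int_cost L xs' us' c b <= rho * int_cost L xs' us' c b.
  by rewrite ler_wpM2r// (le_trans eps1).
have h2 : rho * (int_cost L xs' us' c b + q (xs' b)) <= rho * q (x c).
  by rewrite ler_wpM2l// (le_trans _ rho1).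
move: H3 h1 h2; clear; lra.
Qed.


(** * Large states are expensive *)

Lemma norm_le_enorm (R : realType) (n : nat) (v : 'cV[R]_n) : `|v| <= enorm v.
Proof.
apply: norm_col_le => [|i]; first exact: sqrtr_ge0.
rewrite -sqrtr_sqr /enorm /Hnorm mulmx1 mxE ler_sqrt; last first.
  by apply: sumr_ge0 => j _; rewrite mxE -expr2 sqr_ge0.
rewrite (bigD1 i)//= mxE -expr2 lerDl.
by apply: sumr_ge0 => j _; rewrite mxE -expr2 sqr_ge0.
Qed.

(** The constant kappa must not depend on the interval or on the trajectory:
    along an infinite trajectory it is used for infinitely many stages. The
    time t has a neighbour interval of length tau <= delta / 2 on its left or on
    its right inside the stage, and on it the norm is at least eta / 4. *)
Lemma stage_cost_lower_bound (R : realType) (n m : nat)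
    (f : 'cV[R]_n -> 'cV[R]_m -> 'cV[R]_n) (K : R) (umin umax : 'cV[R]_m)
    (L : 'cV[R]_n -> 'cV[R]_m -> R) (alphaL : R -> R) (delta eta : R) :
  continuous (fun z : 'cV[R]_n * 'cV[R]_m => f z.1 z.2) ->
  (forall v, K.-lipschitz (f ^~ v)) ->
  continuous (fun z : 'cV[R]_n * 'cV[R]_m => L z.1 z.2) ->
  (forall z v, 0 <= L z v) -> class_K alphaL ->
  (forall z v, alphaL (enorm z) <= L z v) -> 0 < delta -> 0 < eta ->
  exists2 kappa, 0 < kappa &
    forall (a t : R) (y : 'cV[R]_n) (u : R -> 'cV[R]_m) (x : R -> 'cV[R]_n),
      trajectory f a (a + delta) y u x ->
      piecewise_continuous a (a + delta) u ->
      (forall s, s \in `[a, a + delta] -> control_box umin umax (u s)) ->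
      t \in `[a, a + delta] -> eta <= `|x t| ->
      kappa <= int_cost L x u a (a + delta).
Proof.
move=> fc flip Lc L0 [_ alpha_incr alpha0] L_alpha delta0 eta0.
have [M0 fM0] := bounded_on_ball_box umin umax 0 fc.
pose M := `|M0| + 1; pose K1 := `|K| + 1.
have M_gt0 : 0 < M by rewrite ltr_wpDl.
have K1_gt0 : 0 < K1 by rewrite ltr_wpDl.
have f_growth z v : control_box umin umax v -> `|f z v| <= K1 * `|z| + M.
  move=> vU; rewrite -[f z v](subrK (f 0 v)) (le_trans (ler_normD _ _))// lerD//.
    apply: le_trans (flip v (z, 0) _) _ => //=.
    by rewrite subr0 ler_wpM2r// (le_trans (ler_norm K))// lerDl.
  have := fM0 0 v; rewrite normr0 => /(_ (lexx _) vU) /= /le_trans; apply.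
  by rewrite (le_trans (ler_norm M0))// lerDl.
(* the three bounds make the interval fit into the stage, make
   [norm_comparison] applicable, and keep its error term 2 * M * tau at most
   eta / 2 *)
pose tau := Num.min (delta / 2) (Num.min (2 * K1)^-1 (eta / (4 * M))).
have tau_gt0 : 0 < tau.
  by rewrite !lt_min divr_gt0//= invr_gt0 mulr_gt0//= divr_gt0// mulr_gt0.
have tau_delta : tau <= delta / 2 by rewrite ge_min lexx.
have tau_K : K1 * tau <= 2^-1.
  rewrite -ler_pdivlMl//; apply: (@le_trans _ _ (2 * K1)^-1).
    by rewrite /tau !ge_min lexx !orbT.
  by rewrite invfM mulrC.
have tau_M : M * tau <= eta / 4.
  rewrite -ler_pdivlMl//; apply: (@le_trans _ _ (eta / (4 * M))).
    by rewrite /tau !ge_min lexx !orbT.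
  by rewrite invfM mulrA mulrC.
have eta4_gt0 : 0 < eta / 4 by rewrite divr_gt0.
have alpha_gt0 : 0 < alphaL (eta / 4).
  by rewrite -alpha0 alpha_incr// in_itv/= ?lexx// ltW.
exists (alphaL (eta / 4) * tau); first exact: mulr_gt0.
move=> a t y u x xu upc uU; rewrite in_itv/= => /andP[at_ tb] etax.
have [xc _ [D xd]] := xu.
have [p ap [ptau pt tp]] : exists2 p, a <= p &
    [/\ p + tau <= a + delta, p <= t & t <= p + tau].
  have [th|/ltW th] := leP t (a + delta / 2); [exists t|exists (t - tau)] => //.
  - by split => //; [move: tau_delta th; clear; lra|rewrite lerDl ltW].
  - by move: tau_delta th; clear; lra.
  - by rewrite subrK lerBlDr lerDl; split => //; exact: ltW.
have Li := running_cost_integrable Lc xc upc uU.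
have ppt : p <= p + tau by rewrite lerDl ltW.
have ptd : p <= a + delta := le_trans ppt ptau.
have sub s : p <= s <= p + tau -> a <= s <= a + delta.
  by move=> /andP[ps sp]; rewrite (le_trans ap ps) (le_trans sp ptau).
have xlow s : s \in `[p, p + tau] -> eta / 4 <= `|x s|.
  move=> sp; have : `|x t| <= 2 * (`|x s| + M * (p + tau - p)).
    apply: (@norm_comparison _ _ x K1 M D p (p + tau)) => //.
    - exact: ltW.
    - exact: ltW.
    - by rewrite addrAC subrr add0r.
    - apply: continuous_subspaceW xc => r /=; rewrite !in_itv/=; exact: sub.
    - move=> r; rewrite in_itv/= => /andP[pr rp] rD.
      have /andP[ar ra] : a < r < a + delta.
        by rewrite (le_lt_trans ap pr) (lt_le_trans rp ptau).
      exists (f (x r) (u r)); first by apply: xd; rewrite ?in_itv/= ?ar.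
      by apply: f_growth; apply: uU; rewrite in_itv/= !ltW.
    - by rewrite in_itv/= pt.
  have -> : p + tau - p = tau by ring.
  by move: tau_M etax; clear; lra.
have Lpi := integrable_subitv ap ptau Li.
rewrite (int_cost_split Li ap ptd).
rewrite (int_cost_split (integrable_subitv ap (lexx _) Li) ppt ptau).
have h1 := int_cost_ge0 x u a p L0.
have h2 := int_cost_ge0 x u (p + tau) (a + delta) L0.
suff : alphaL (eta / 4) * tau <= int_cost L x u p (p + tau).
  by move: h1 h2; clear; lra.
have <- : \int[lebesgue_measure]_(s in `[p, p + tau]) alphaL (eta / 4)
    = alphaL (eta / 4) * tau.
  have mu_itv : lebesgue_measure (`[p, p + tau]%classic : set R) = tau%:E.
    rewrite lebesgue_measure_itv/= lte_fin ltrDl tau_gt0 -EFinB.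
    by rewrite addrAC subrr add0r.
  rewrite Rintegral_cst//; congr (_ * _).
  exact: (congr1 fine mu_itv).
apply: le_Rintegral => //.
  apply: measurable_bounded_integrable => //.
    exact/compact_finite_measure/segment_compact.
  exact: bounded_cst.
move=> s sp; apply: le_trans (L_alpha (x s) (u s)).
have := le_trans (xlow s sp) (norm_le_enorm (x s)).
rewrite le_eqVlt => /predU1P[<-//|lts]; apply/ltW/alpha_incr => //.
  by rewrite in_itv/= ltW.
by rewrite in_itv/= (le_trans (ltW eta4_gt0))// ltW.
Qed.

(** * Convergence *)

Lemma nonincreasing_increment_small (R : realType) (V : nat -> R) (e : R) :
  (forall i, V i.+1 <= V i) -> (forall i, 0 <= V i) -> 0 < e ->
  \forall i \near \oo, V i - V i.+1 < e.
Proof.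
move=> Vdec V0 e0.
have Vc : cvgn V.
  apply: nonincreasing_is_cvgn; first exact/nonincreasing_seqP.
  by exists 0 => _ [i _ <-]; exact: V0.
have Vs : (fun i => V i - V i.+1) @ \oo --> limn V - limn V.
  by apply: cvgB => //; rewrite cvg_shiftS.
rewrite subrr in Vs; have /cvgr0Pnorm_lt /(_ _ e0) := Vs.
by apply: filterS => i; exact: le_lt_trans (ler_norm _).
Qed.

Theorem theorem3p1 (R : realType) (n m : nat)
  (* system, control constraints, terminal set, time parameters *)
  (f : 'cV[R]_n -> 'cV[R]_m -> 'cV[R]_n)
  (f_C1 : C1 (fun z : 'cV[R]_n * 'cV[R]_m => f z.1 z.2))
  (f0 : f 0 0 = 0)
  (f_lip : exists K : R, forall u : 'cV[R]_m, K.-lipschitz (f ^~ u))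
  (umin umax : 'cV[R]_m)
  (umin_lt0 : forall j, umin j 0 < 0) (umax_gt0 : forall j, 0 < umax j 0)
  (Omega : set 'cV[R]_n)
  (Omega_closed : closed Omega) (Omega_bounded : bounded_set Omega)
  (Omega_sc : simply_connected Omega) (Omega0 : Omega 0)
  (Tmin delta : R) (delta_gt0 : 0 < delta) (delta_le : delta <= Tmin)
  (ctrl : asymptotically_controllable f (control_box umin umax) Omega)
  (* cost *)
  (L : 'cV[R]_n -> 'cV[R]_m -> R)
  (L_C1 : C1 (fun z : 'cV[R]_n * 'cV[R]_m => L z.1 z.2))
  (L_ge0 : forall x u, 0 <= L x u) (L0 : L 0 0 = 0)
  (alphaL : R -> R) (alphaL_K : class_K alphaL)
  (L_alphaL : forall x u, alphaL (enorm x) <= L x u)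
  (q : 'cV[R]_n -> R) (q_C1 : C1 q) (q_ge0 : forall x, 0 <= q x) (q0 : q 0 = 0)
  (H : 'M[R]_n) (H_pd : sym_posdef H)
  (c : R) (c_gt0 : 0 < c) (q_H : forall x, c * Hnorm H x ^+ 2 <= q x)
  (eps rho : nat -> R)
  (eps_01 : forall i, 0 <= eps i <= 1) (rho_ge1 : forall i, 1 <= rho i)
  (* closed loop *)
  (x0 : 'cV[R]_n)
  (T : nat -> R) (u : nat -> R -> 'cV[R]_m) (x : nat -> R -> 'cV[R]_n)
  (ustar : R -> 'cV[R]_m) (xstar : R -> 'cV[R]_n)
  (loop : closed_loop f (control_box umin umax) Omega L q Tmin delta eps rho x0
            T u x ustar xstar)
  (* solvability of the problems for all initial states in X *)
  (X : set 'cV[R]_n) (Omega_X : Omega `<=` X)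
  (xstar_X : forall i, X (xstar (sample delta i)))
  (X_solv : forall i y, X y -> exists T' u' x',
     solves_P f (control_box umin umax) Omega L q Tmin (eps i) (rho i)
       (sample delta i) y T' u' x')
  (* assumption 1, with the chosen control and trajectory for each y in Omega *)
  (us : 'cV[R]_n -> R -> 'cV[R]_m) (xs : 'cV[R]_n -> R -> 'cV[R]_n)
  (H1 : forall y, Omega y ->
     local_decrease f (control_box umin umax) Omega L q delta y (us y) (xs y))
  (* assumption 2 *)
  (H2 : exists T' u' x',
     solves_P f (control_box umin umax) Omega L q Tmin (eps 0%N) (rho 0%N)
       0 x0 T' u' x')
  (* assumption 3 *)
  (xi : R) (xi_01 : 0 < xi < 1)
  (H3 : forall i,
     let t := sample delta i in
     let Deps := eps i.+1 - eps i in
     let Drho := rho i.+1 - rho i in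
     let y := x i (t + T i) in
     let u_s := fun s => us y (s - (t + T i)) in
     let x_s := fun s => xs y (s - (t + T i)) in
     (Tmin + delta <= T i ->
       Deps * int_cost L (x i) (u i) (t + delta) (t + T i) + Drho * q y
       <= delta + (1 - xi) * eps i * int_cost L (x i) (u i) t (t + delta)) /\
     (Tmin <= T i < Tmin + delta ->
       Deps * (int_cost L (x i) (u i) (t + delta) (t + T i) +
               int_cost L x_s u_s (t + T i) (t + Tmin + delta))
       + Drho * q (x_s (t + Tmin + delta))
       <= (T i - Tmin)
          + (1 - xi) * eps i * int_cost L (x i) (u i) t (t + delta)))
  (* assumption 4 *)
  (H4 : exists (i0 : nat) (epsmin : R), 0 < epsmin /\
     forall i, (i0 <= i)%N -> epsmin <= eps i <= 1) :
  xstar s @[s --> +oo] --> (0 : 'cV[R]_n).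
Proof.
have [K flip] := f_lip.
have fc := C1_continuous f_C1; have Lc := C1_continuous L_C1.
have qc := C1_continuous q_C1.
have [xs0 xsol xstar_x _] := loop.
have [i0 [epsmin [epsmin0 epsH]]] := H4.
have [xi0 _] := andP xi_01.
pose t := sample delta.
have tS i : t i.+1 = t i + delta by rewrite /t /sample -natr1 mulrDl mul1r.
have x_next i : xstar (t i.+1) = x i (t i + delta).
  rewrite -tS; apply: xstar_x; rewrite in_itv/= lexx andbT.
  by rewrite -/t tS lerDl ltW.
pose V i := cost L q (eps i) (rho i) (t i) (T i) (u i) (x i).
pose I i := int_cost L (x i) (u i) (t i) (t i + delta).
have I0 i : 0 <= I i by exact: int_cost_ge0.
have Vdec i : V i.+1 <= V i - xi * (eps i * I i).
  have := xsol i.+1; rewrite -/t x_next tS => soln.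
  have [Hl Hs] := H3 i.
  rewrite /V tS; apply: (value_decrease (us := us) (xs := xs) flip Lc qc L_ge0
    delta_gt0 delta_le _ (rho_ge1 i) H1 (xsol i) soln Hl Hs).
  by have /andP[] := eps_01 i.
have V0 i : 0 <= V i.
  have [TminT _ _ _] := xsol i; have /andP[e0 _] := eps_01 i.
  rewrite /V /cost !addr_ge0//.
  - by rewrite (le_trans _ TminT)// (le_trans _ delta_le)// ltW.
  - by rewrite mulr_ge0// int_cost_ge0.
  - by rewrite mulr_ge0// (le_trans _ (rho_ge1 i)).
have V_noninc i : V i.+1 <= V i.
  apply: le_trans (Vdec i) _; rewrite gerBl mulr_ge0 ?(ltW xi0)// mulr_ge0//.
  by have /andP[] := eps_01 i.
apply/cvgr0Pnorm_lt => eta eta0.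
have [kappa kappa0 I_low] := stage_cost_lower_bound umin umax fc flip Lc L_ge0
  alphaL_K L_alphaL delta_gt0 eta0.
have e0 : 0 < xi * (epsmin * kappa) by rewrite !mulr_gt0.
have [N _ NV] := nonincreasing_increment_small V_noninc V0 e0.
(* a stage with a state of norm at least eta would lower V by xi * epsmin * kappa *)
have small i s : (N <= i)%N -> (i0 <= i)%N -> s \in `[t i, t i.+1] ->
    `|xstar s| < eta.
  move=> Ni i0i si; rewrite (xstar_x _ _ si) ltNge; apply/negP => etax.
  have [TminT [upc uU _] xu _] := xsol i; rewrite -/t in upc uU xu.
  have tiT : t i + delta <= t i + T i by rewrite lerD2l (le_trans delta_le).
  have xu' := trajectory_sub (lexx _) tiT xu.
  have upc' := piecewise_continuous_sub (lexx _) tiT upc.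
  have uU' r : r \in `[t i, t i + delta] -> control_box umin umax (u i r).
    rewrite in_itv/= => /andP[tr rt]; apply: uU.
    by rewrite in_itv/= tr (le_trans rt).
  have kI : kappa <= I i.
    by apply: I_low xu' upc' uU' _ etax; rewrite -tS.
  have /andP[e1 _] := epsH i i0i.
  have : xi * (epsmin * kappa) <= xi * (eps i * I i).
    by rewrite ler_pM2l// ler_pM// ltW.
  apply/negP; rewrite -ltNge; apply: le_lt_trans (NV i Ni).
  by rewrite lerBrDr addrC -lerBrDr.
(* the stage containing s is the integer part of s / delta *)
apply: filterS (nbhs_pinfty_ge (num_real (t (maxn N i0)))) => s ts.
have s0 : 0 <= s / delta.
  by rewrite divr_ge0 ?(ltW delta_gt0)// (le_trans _ ts)// mulr_ge0// ltW.
have /andP[ks sk] := truncn_itv s0; set k := Num.truncn _ in ks sk.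
have Nk : (maxn N i0 <= k)%N.
  rewrite -ltnS -(ltr_nat R); apply: le_lt_trans sk.
  by rewrite ler_pdivlMr.
apply: (small k).
- exact: leq_trans (leq_maxl _ _) Nk.
- exact: leq_trans (leq_maxr _ _) Nk.
- by rewrite in_itv/= /t /sample -ler_pdivlMr// ks -ler_pdivrMr// ltW.
Qed.
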